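(* Let $P,Q\in B(\mathsf{h})$ be orthogonal projections on a Hilbert space $\mathsf{h}$, and let $L$ be a generating functional in a Schürmann triple $(\rho(P,Q),\eta,L)$ on $\mathrm{Pol}(S_4^+)$. Let $\xi=\eta(p_{11})$ and $\zeta=\eta(p_{33})$. Then $L$ is symmetric (i.e. $L\circ S=L$) if and only if $$\big\langle\zeta,(PQ)^k\xi\big\rangle=\big\langle(PQ)^k\xi,\zeta\big\rangle\quad\text{for all } k\ge0.$$
   Context: $\mathrm{Pol}(S_4^+)$ is the universal unital $*$-algebra generated by $p_{ij}$ ($1\le i,j\le4$) subject to $p_{ij}=p_{ij}^*=p_{ij}^2$, $p_{ij}p_{ik}=0=p_{ji}p_{ki}$ for $j\ne k$, and $\sum_j p_{ij}=\sum_j p_{ji}=1$ for all $i$. Its counit $\varepsilon$ is the character with $\varepsilon(p_{ij})=\delta_{ij}$; its antipode $S$ is the linear anti-multiplicative map with $S(p_{ij})=p_{ji}$. $\rho(P,Q):\mathrm{Pol}(S_4^+)\to B(\mathsf{h})$ is the unital $*$-homomorphism sending the matrix $[p_{ij}]$ to $$\begin{bmatrix}P&1-P&0&0\\1-P&P&0&0\\0&0&Q&1-Q\\0&0&1-Q&Q\end{bmatrix}.$$ A Schürmann triple $(\rho,\eta,L)$ consists of a unital $*$-homomorphism $\rho:\mathrm{Pol}(S_4^+)\to B(\mathsf{h})$, a linear map $\eta:\mathrm{Pol}(S_4^+)\to\mathsf{h}$ with $\eta(ab)=\rho(a)\eta(b)+\eta(a)\varepsilon(b)$, and a hermitian functional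 $L$ with $L(a^*b)=\langle\eta(a),\eta(b)\rangle+\varepsilon(a^* )L(b)+L(a^* )\varepsilon(b)$ for all $a,b$ (inner product linear in the second argument). For $\rho=\rho(P,Q)$ the cocycle has the form $\eta(p_{11})=\eta(p_{22})=\xi=-\eta(p_{12})=-\eta(p_{21})$, $\eta(p_{33})=\eta(p_{44})=\zeta=-\eta(p_{34})=-\eta(p_{43})$ and $\eta(p_{ij})=0$ for all other $i,j$, where $P\xi=0$ and $Q\zeta=0$. *)

(* Defs.v *)
From HB Require Import structures.
From mathcomp Require Import all_boot all_order all_algebra.
From mathcomp Require Import generic_quotient.
From mathcomp Require Import complex.
From mathcomp Require Import boolp classical_sets reals topology normedtype.

Set Implicit Arguments.
Unset Strict Implicit.
Unset Printing Implicit Defensive.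

Import Order.TTheory GRing.Theory Num.Theory.
Import numFieldNormedType.Exports.

Local Open Scope ring_scope.
Local Open Scope quotient_scope.

(* [algType] excludes the zero algebra; this is harmless, since Pol is nonzero. *)
HB.mixin Record Algebra_hasStar (C : numClosedFieldType) A
    of GRing.Algebra C A := {
  star : A -> A;
  starK : involutive star;
  starD : {morph star : x y / x + y};
  starM : forall x y : A, star (x * y) = star y * star x;
  starZ : forall (c : C) (x : A), star (c *: x) = c^* *: star x
}.

#[short(type="starAlgType")]
HB.structure Definition StarAlgebra (C : numClosedFieldType) :=
  {A of GRing.Algebra C A & Algebra_hasStar C A}.

Section ScalarStar.
Variable R : realType.

Lemma scalar_starK : involutive (fun x : R[i]^o => (x : R[i])^* : R[i]^o).
Proof. by move=> x; rewrite conjCK. Qed.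

Lemma scalar_starD :
  {morph (fun x : R[i]^o => (x : R[i])^* : R[i]^o) : x y / x + y}.
Proof. by move=> x y; rewrite rmorphD. Qed.

Lemma scalar_starM (x y : R[i]^o) :
  ((x * y : R[i]^o) : R[i])^* = (y : R[i])^* * (x : R[i])^*.
Proof. by rewrite rmorphM mulrC. Qed.

Lemma scalar_starZ (c : R[i]) (x : R[i]^o) :
  ((c *: x : R[i]^o) : R[i])^* = c^* *: ((x : R[i])^* : R[i]^o).
Proof. by rewrite -[c *: x]/(c * x) rmorphM. Qed.

HB.instance Definition _ := Algebra_hasStar.Build R[i] R[i]^o
  scalar_starK scalar_starD scalar_starM scalar_starZ.

End ScalarStar.

Record magic (C : numClosedFieldType) (A : starAlgType C)
    (q : 'I_4 -> 'I_4 -> A) : Prop := Magic {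
  magic_star : forall i j, star (q i j) = q i j;
  magic_idem : forall i j, q i j * q i j = q i j;
  magic_row : forall i j k, j != k -> q i j * q i k = 0;
  magic_col : forall i j k, j != k -> q j i * q k i = 0;
  magic_rowsum : forall i, \sum_j q i j = 1;
  magic_colsum : forall i, \sum_j q j i = 1
}.

(* Pol is the set of *-polynomial expressions in the generators modulo the
   smallest congruence [cong] that contains the axioms of unital *-algebras and
   the defining relations. Its universal property is [lift_gen], [lift_star],
   [lift_unique] and the [lrmorphism] structure of [lift]. *)
Inductive term (R : realType) : Type :=
| Gen of 'I_4 & 'I_4
| Zero
| One
| Add of term R & term R
| Mul of term R & term R
| Scale of R[i] & term R
| Star of term R.

Arguments Gen {R}.
Arguments Zero {R}.
Arguments One {R}.

Inductive cong (R : realType) : term R -> term R -> Prop :=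
| cong_refl s : cong s s
| cong_sym s t : cong s t -> cong t s
| cong_trans s t u : cong s t -> cong t u -> cong s u
| cong_Add s s' t t' : cong s s' -> cong t t' -> cong (Add s t) (Add s' t')
| cong_Mul s s' t t' : cong s s' -> cong t t' -> cong (Mul s t) (Mul s' t')
| cong_Scale c s s' : cong s s' -> cong (Scale c s) (Scale c s')
| cong_Star s s' : cong s s' -> cong (Star s) (Star s')
| cong_addA s t u : cong (Add s (Add t u)) (Add (Add s t) u)
| cong_addC s t : cong (Add s t) (Add t s)
| cong_add0 s : cong (Add Zero s) s
| cong_addN s : cong (Add (Scale (-1) s) s) Zero
| cong_mulA s t u : cong (Mul s (Mul t u)) (Mul (Mul s t) u)
| cong_mul1l s : cong (Mul One s) s
| cong_mul1r s : cong (Mul s One) s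
| cong_mulDl s t u : cong (Mul (Add s t) u) (Add (Mul s u) (Mul t u))
| cong_mulDr s t u : cong (Mul s (Add t u)) (Add (Mul s t) (Mul s u))
| cong_scaleA c d s : cong (Scale c (Scale d s)) (Scale (c * d) s)
| cong_scale1 s : cong (Scale 1 s) s
| cong_scaleDr c s t : cong (Scale c (Add s t)) (Add (Scale c s) (Scale c t))
| cong_scaleDl c d s : cong (Scale (c + d) s) (Add (Scale c s) (Scale d s))
| cong_scaleAl c s t : cong (Scale c (Mul s t)) (Mul (Scale c s) t)
| cong_scaleAr c s t : cong (Scale c (Mul s t)) (Mul s (Scale c t))
| cong_starK s : cong (Star (Star s)) s
| cong_starD s t : cong (Star (Add s t)) (Add (Star s) (Star t))
| cong_starM s t : cong (Star (Mul s t)) (Mul (Star t) (Star s))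
| cong_starZ c s : cong (Star (Scale c s)) (Scale c^* (Star s))
| cong_gen_star i j : cong (Star (Gen i j)) (Gen i j)
| cong_gen_idem i j : cong (Mul (Gen i j) (Gen i j)) (Gen i j)
| cong_gen_row i j k : j != k -> cong (Mul (Gen i j) (Gen i k)) Zero
| cong_gen_col i j k : j != k -> cong (Mul (Gen j i) (Gen k i)) Zero
| cong_gen_rowsum i : cong (\big[@Add R/Zero]_j Gen i j) One
| cong_gen_colsum i : cong (\big[@Add R/Zero]_j Gen j i) One.

Section Eval.
Variables (R : realType) (A : starAlgType R[i]) (q : 'I_4 -> 'I_4 -> A).

Fixpoint eval (t : term R) : A :=
  match t with
  | Gen i j => q i j
  | Zero => 0
  | One => 1
  | Add s t => eval s + eval t
  | Mul s t => eval s * eval t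
  | Scale c s => c *: eval s
  | Star s => star (eval s)
  end.

Lemma eval_cong : magic q -> forall s t, cong s t -> eval s = eval t.
Proof.
case=> qS qI qr qc qrs qcs s t; elim=> //=.
- by move=> s1 s2 s3 _ -> _ ->.
- by move=> s1 s2 s3 s4 _ -> _ ->.
- by move=> s1 s2 s3 s4 _ -> _ ->.
- by move=> c s1 s2 _ ->.
- by move=> s1 s2 _ ->.
- by move=> *; rewrite addrA.
- by move=> *; rewrite addrC.
- by move=> *; rewrite add0r.
- by move=> u; rewrite scaleN1r addNr.
- by move=> *; rewrite mulrA.
- by move=> *; rewrite mul1r.
- by move=> *; rewrite mulr1.
- by move=> *; rewrite mulrDl.
- by move=> *; rewrite mulrDr.
- by move=> *; rewrite scalerA.
- by move=> *; rewrite scale1r.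
- by move=> *; rewrite scalerDr.
- by move=> *; rewrite scalerDl.
- by move=> *; rewrite scalerAl.
- by move=> *; rewrite scalerAr.
- by move=> *; rewrite starK.
- by move=> *; rewrite starD.
- by move=> *; rewrite starM.
- by move=> *; rewrite starZ.
- by move=> i; rewrite (big_morph eval (id1 := 0) (op1 := +%R)) //; exact: qrs.
- by move=> i; rewrite (big_morph eval (id1 := 0) (op1 := +%R)) //; exact: qcs.
Qed.

End Eval.

Lemma magic_delta (R : realType) :
  magic (fun i j : 'I_4 => (i == j)%:R : R[i]^o).
Proof.
split=> /=.
- by move=> i j; rewrite -[LHS]/((_%:R : R[i])^*) rmorph_nat.
- by move=> i j; case: eqP; rewrite ?mulr1 ?mulr0.
- move=> i j k jk; case: (eqVneq i j) => [->|]; last by rewrite mul0r.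
  by rewrite (negPf jk) mulr0.
- move=> i j k jk; case: (eqVneq j i) => [<-|]; last by rewrite mul0r.
  by rewrite [k == j]eq_sym (negPf jk) mulr0.
- move=> i; rewrite (bigD1 i) //= eqxx big1 ?addr0 // => j ji.
  by rewrite eq_sym (negPf ji).
- move=> i; rewrite (bigD1 i) //= eqxx big1 ?addr0 // => j ji.
  by rewrite (negPf ji).
Qed.

HB.instance Definition _ (R : realType) := gen_eqMixin (term R).
HB.instance Definition _ (R : realType) := gen_choiceMixin (term R).

Section Pol.
Variable R : realType.

Definition congb (s t : term R) : bool := `[< cong s t >].

Lemma congb_refl : reflexive congb.
Proof. by move=> s; apply/asboolP; exact: cong_refl. Qed.

Lemma congb_sym : symmetric congb.
Proof. by move=> s t; apply/asboolP/asboolP; exact: cong_sym. Qed.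

Lemma congb_trans : transitive congb.
Proof.
move=> t s u /asboolP st /asboolP tu; apply/asboolP; exact: cong_trans st tu.
Qed.

Canonical cong_equiv := EquivRel congb congb_refl congb_sym congb_trans.

Definition Pol : Type := {eq_quot cong_equiv}.

HB.instance Definition _ := Choice.on Pol.
HB.instance Definition _ := EqQuotient.on Pol.

Definition cls (t : term R) : Pol := \pi_Pol t.

Lemma clsP s t : cong s t <-> cls s = cls t.
Proof.
split=> [st|/eqmodP /asboolP //]; apply/eqmodP; exact/asboolP.
Qed.

Lemma clsK (a : Pol) : cls (repr a) = a. Proof. exact: reprK. Qed.

Lemma cong_repr t : cong (repr (cls t)) t.
Proof. by apply/clsP; rewrite clsK. Qed.

Lemma Pol_ind (T : Pol -> Prop) : (forall t, T (cls t)) -> forall a, T a.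
Proof. by move=> Tcls a; rewrite -(clsK a). Qed.

Definition Pol_add (a b : Pol) := cls (Add (repr a) (repr b)).
Definition Pol_opp (a : Pol) := cls (Scale (-1) (repr a)).
Definition Pol_mul (a b : Pol) := cls (Mul (repr a) (repr b)).
Definition Pol_scale (c : R[i]) (a : Pol) := cls (Scale c (repr a)).
Definition Pol_star (a : Pol) := cls (Star (repr a)).

Lemma Pol_addE s t : Pol_add (cls s) (cls t) = cls (Add s t).
Proof. by apply/clsP; apply: cong_Add; exact: cong_repr. Qed.
Lemma Pol_oppE s : Pol_opp (cls s) = cls (Scale (-1) s).
Proof. by apply/clsP; apply: cong_Scale; exact: cong_repr. Qed.
Lemma Pol_mulE s t : Pol_mul (cls s) (cls t) = cls (Mul s t).
Proof. by apply/clsP; apply: cong_Mul; exact: cong_repr. Qed.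
Lemma Pol_scaleE c s : Pol_scale c (cls s) = cls (Scale c s).
Proof. by apply/clsP; apply: cong_Scale; exact: cong_repr. Qed.
Lemma Pol_starE s : Pol_star (cls s) = cls (Star s).
Proof. by apply/clsP; apply: cong_Star; exact: cong_repr. Qed.

Definition PolE := (Pol_addE, Pol_oppE, Pol_mulE, Pol_scaleE, Pol_starE).

Lemma Pol_addA : associative Pol_add.
Proof.
by elim/Pol_ind=> s; elim/Pol_ind=> t; elim/Pol_ind=> u;
   rewrite !PolE; apply/clsP; exact: cong_addA.
Qed.
Lemma Pol_addC : commutative Pol_add.
Proof.
by elim/Pol_ind=> s; elim/Pol_ind=> t; rewrite !PolE; apply/clsP;
   exact: cong_addC.
Qed.
Lemma Pol_add0 : left_id (cls Zero) Pol_add.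
Proof. by elim/Pol_ind=> s; rewrite !PolE; apply/clsP; exact: cong_add0. Qed.
Lemma Pol_addN : left_inverse (cls Zero) Pol_opp Pol_add.
Proof. by elim/Pol_ind=> s; rewrite !PolE; apply/clsP; exact: cong_addN. Qed.

HB.instance Definition _ :=
  GRing.isZmodule.Build Pol Pol_addA Pol_addC Pol_add0 Pol_addN.

Lemma Pol_mulA : associative Pol_mul.
Proof.
by elim/Pol_ind=> s; elim/Pol_ind=> t; elim/Pol_ind=> u;
   rewrite !PolE; apply/clsP; exact: cong_mulA.
Qed.
Lemma Pol_mul1l : left_id (cls One) Pol_mul.
Proof. by elim/Pol_ind=> s; rewrite !PolE; apply/clsP; exact: cong_mul1l. Qed.
Lemma Pol_mul1r : right_id (cls One) Pol_mul.
Proof. by elim/Pol_ind=> s; rewrite !PolE; apply/clsP; exact: cong_mul1r. Qed.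
Lemma Pol_mulDl : left_distributive Pol_mul +%R.
Proof.
by elim/Pol_ind=> s; elim/Pol_ind=> t; elim/Pol_ind=> u;
   rewrite /GRing.add /= !PolE; apply/clsP; exact: cong_mulDl.
Qed.
Lemma Pol_mulDr : right_distributive Pol_mul +%R.
Proof.
by elim/Pol_ind=> s; elim/Pol_ind=> t; elim/Pol_ind=> u;
   rewrite /GRing.add /= !PolE; apply/clsP; exact: cong_mulDr.
Qed.
Lemma Pol_oner_neq0 : cls One != 0.
Proof.
apply/eqP => /clsP /(eval_cong (magic_delta R)) /= /eqP.
by rewrite oner_eq0.
Qed.

HB.instance Definition _ := GRing.Zmodule_isNzRing.Build Pol
  Pol_mulA Pol_mul1l Pol_mul1r Pol_mulDl Pol_mulDr Pol_oner_neq0.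

Lemma Pol_scaleA c d (a : Pol) :
  Pol_scale c (Pol_scale d a) = Pol_scale (c * d) a.
Proof.
by elim/Pol_ind: a => s; rewrite !PolE; apply/clsP; exact: cong_scaleA.
Qed.
Lemma Pol_scale1 : left_id 1 Pol_scale.
Proof. by elim/Pol_ind=> s; rewrite !PolE; apply/clsP; exact: cong_scale1. Qed.
Lemma Pol_scaleDr : right_distributive Pol_scale +%R.
Proof.
by move=> c; elim/Pol_ind=> s; elim/Pol_ind=> t;
   rewrite /GRing.add /= !PolE; apply/clsP; exact: cong_scaleDr.
Qed.
Lemma Pol_scaleDl (a : Pol) : {morph Pol_scale^~ a : c d / c + d}.
Proof.
by move=> c d; elim/Pol_ind: a => s;
   rewrite [in RHS]/GRing.add /= !PolE; apply/clsP; exact: cong_scaleDl.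
Qed.

HB.instance Definition _ := GRing.Zmodule_isLmodule.Build R[i] Pol
  Pol_scaleA Pol_scale1 Pol_scaleDr Pol_scaleDl.

Lemma Pol_scaleAl (c : R[i]) (a b : Pol) : c *: (a * b) = (c *: a) * b.
Proof.
elim/Pol_ind: a => s; elim/Pol_ind: b => t.
by rewrite /GRing.scale /GRing.mul /= !PolE; apply/clsP; exact: cong_scaleAl.
Qed.

HB.instance Definition _ := GRing.Lmodule_isLalgebra.Build R[i] Pol Pol_scaleAl.

Lemma Pol_scaleAr (c : R[i]) (a b : Pol) : c *: (a * b) = a * (c *: b).
Proof.
elim/Pol_ind: a => s; elim/Pol_ind: b => t.
by rewrite /GRing.scale /GRing.mul /= !PolE; apply/clsP; exact: cong_scaleAr.
Qed.

HB.instance Definition _ := GRing.Lalgebra_isAlgebra.Build R[i] Pol Pol_scaleAr.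

Lemma Pol_starK : involutive Pol_star.
Proof. by elim/Pol_ind=> s; rewrite !PolE; apply/clsP; exact: cong_starK. Qed.
Lemma Pol_starD : {morph Pol_star : a b / a + b}.
Proof.
by elim/Pol_ind=> s; elim/Pol_ind=> t; rewrite /GRing.add /= !PolE; apply/clsP;
   exact: cong_starD.
Qed.
Lemma Pol_starM (a b : Pol) : Pol_star (a * b) = Pol_star b * Pol_star a.
Proof.
elim/Pol_ind: a => s; elim/Pol_ind: b => t.
by rewrite /GRing.mul /= !PolE; apply/clsP; exact: cong_starM.
Qed.
Lemma Pol_starZ (c : R[i]) (a : Pol) : Pol_star (c *: a) = c^* *: Pol_star a.
Proof.
elim/Pol_ind: a => s.
by rewrite /GRing.scale /= !PolE; apply/clsP; exact: cong_starZ.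
Qed.

HB.instance Definition _ := Algebra_hasStar.Build R[i] Pol
  Pol_starK Pol_starD Pol_starM Pol_starZ.

Lemma cls0 : cls Zero = 0. Proof. by []. Qed.
Lemma cls1 : cls One = 1. Proof. by []. Qed.
Lemma clsD s t : cls (Add s t) = cls s + cls t.
Proof. by rewrite -Pol_addE. Qed.
Lemma clsM s t : cls (Mul s t) = cls s * cls t.
Proof. by rewrite -Pol_mulE. Qed.
Lemma clsZ c s : cls (Scale c s) = c *: cls s.
Proof. by rewrite -Pol_scaleE. Qed.
Lemma clsS s : cls (Star s) = star (cls s).
Proof. by rewrite -Pol_starE. Qed.

Definition gen (i j : 'I_4) : Pol := cls (Gen i j).

Lemma gen_magic : magic gen.
Proof.
split.
- by move=> i j; rewrite -clsS; apply/clsP; exact: cong_gen_star.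
- by move=> i j; rewrite -clsM; apply/clsP; exact: cong_gen_idem.
- by move=> i j k jk; rewrite -clsM -cls0; apply/clsP; exact: cong_gen_row.
- by move=> i j k jk; rewrite -clsM -cls0; apply/clsP; exact: cong_gen_col.
- move=> i; rewrite -(big_morph cls clsD cls0) -cls1.
  by apply/clsP; exact: cong_gen_rowsum.
- move=> i; rewrite -(big_morph cls clsD cls0) -cls1.
  by apply/clsP; exact: cong_gen_colsum.
Qed.

End Pol.

Section Lift.
Variables (R : realType) (A : starAlgType R[i]) (q : 'I_4 -> 'I_4 -> A).
Hypothesis qP : magic q.

(* [qP] makes this independent of the chosen representative: [lift_cls]. *)
Definition lift of magic q : Pol R -> A := fun a => eval q (repr a).

Lemma lift_cls t : lift qP (cls t) = eval q t.
Proof. exact: (eval_cong qP (cong_repr t)). Qed.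

Lemma lift_linear : linear (lift qP).
Proof.
move=> c; elim/Pol_ind=> s; elim/Pol_ind=> t.
by rewrite -clsZ -clsD !lift_cls.
Qed.

Lemma lift_monoid : monoid_morphism (lift qP).
Proof.
split; first by rewrite -cls1 lift_cls.
by elim/Pol_ind=> s; elim/Pol_ind=> t; rewrite -clsM !lift_cls.
Qed.

HB.instance Definition _ := GRing.isLinear.Build R[i] (Pol R) A _ (lift qP)
  lift_linear.
HB.instance Definition _ := GRing.isMonoidMorphism.Build (Pol R) A (lift qP)
  lift_monoid.

Lemma lift_gen i j : lift qP (gen R i j) = q i j.
Proof. exact: lift_cls. Qed.

Lemma lift_star a : lift qP (star a) = star (lift qP a).
Proof. by elim/Pol_ind: a => s; rewrite -clsS !lift_cls. Qed.

Lemma lift_unique (f : {lrmorphism Pol R -> A}) :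
    (forall a, f (star a) = star (f a)) -> (forall i j, f (gen R i j) = q i j) ->
  f =1 lift qP.
Proof.
move=> fS fG; elim/Pol_ind; elim=> [i j|||s fs t ft|s fs t ft|c s fs|s fs].
- by rewrite lift_gen -fG.
- by rewrite cls0 !linear0.
- by rewrite cls1 !rmorph1.
- by rewrite clsD linearD /= fs ft [RHS]linearD.
- by rewrite clsM rmorphM /= fs ft [RHS]rmorphM.
- by rewrite clsZ linearZ /= fs [RHS]linearZ.
- by rewrite clsS fS lift_star fs.
Qed.

End Lift.

Section Counit.
Variable R : realType.

Definition counit : Pol R -> R[i] := lift (magic_delta R).

Lemma counit_gen i j : counit (gen R i j) = (i == j)%:R.
Proof. exact: (lift_gen (magic_delta R)). Qed.

Lemma counit_star a : counit (star a) = (counit a)^*.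
Proof. exact: (lift_star (magic_delta R)). Qed.

Lemma counit_linear : linear_for *%R counit.
Proof. exact: (lift_linear (magic_delta R)). Qed.

Lemma counit_monoid : monoid_morphism counit.
Proof. exact: (lift_monoid (magic_delta R)). Qed.

HB.instance Definition _ := GRing.isLinear.Build R[i] (Pol R) R[i] _ counit
  counit_linear.
HB.instance Definition _ := GRing.isMonoidMorphism.Build (Pol R) R[i] counit
  counit_monoid.

End Counit.

Section Antipode.
Variable R : realType.

Fixpoint term_antipode (t : term R) : term R :=
  match t with
  | Gen i j => Gen j i
  | Zero => Zero
  | One => One
  | Add s t => Add (term_antipode s) (term_antipode t)
  | Mul s t => Mul (term_antipode t) (term_antipode s)
  | Scale c s => Scale c (term_antipode s)
  | Star s => Star (term_antipode s)
  end.

Lemma term_antipode_cong s t :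
  cong s t -> cong (term_antipode s) (term_antipode t).
Proof.
elim=> /=.
- by move=> *; apply: cong_refl.
- by move=> s1 s2 _; exact: cong_sym.
- by move=> s1 s2 s3 _ h1 _; exact: cong_trans.
- by move=> *; apply: cong_Add.
- by move=> *; apply: cong_Mul.
- by move=> *; apply: cong_Scale.
- by move=> *; apply: cong_Star.
- by move=> *; apply: cong_addA.
- by move=> *; apply: cong_addC.
- by move=> *; apply: cong_add0.
- by move=> *; apply: cong_addN.
- by move=> *; apply/cong_sym/cong_mulA.
- by move=> *; apply: cong_mul1r.
- by move=> *; apply: cong_mul1l.
- by move=> *; apply: cong_mulDr.
- by move=> *; apply: cong_mulDl.
- by move=> *; apply: cong_scaleA.
- by move=> *; apply: cong_scale1.
- by move=> *; apply: cong_scaleDr.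
- by move=> *; apply: cong_scaleDl.
- by move=> *; apply: cong_scaleAr.
- by move=> *; apply: cong_scaleAl.
- by move=> *; apply: cong_starK.
- by move=> *; apply: cong_starD.
- by move=> *; apply: cong_starM.
- by move=> *; apply: cong_starZ.
- by move=> *; apply: cong_gen_star.
- by move=> *; apply: cong_gen_idem.
- by move=> i j k jk; apply: cong_gen_col; rewrite eq_sym.
- by move=> i j k jk; apply: cong_gen_row; rewrite eq_sym.
- move=> i; rewrite (big_morph term_antipode (id1 := Zero) (op1 := @Add R)) //.
  exact: cong_gen_colsum.
- move=> i; rewrite (big_morph term_antipode (id1 := Zero) (op1 := @Add R)) //.
  exact: cong_gen_rowsum.
Qed.

(* Well defined by [term_antipode_cong]; characterised by [antipode_linear],
   [antipodeM] and [antipode_gen]. *)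
Definition antipode (a : Pol R) : Pol R := cls (term_antipode (repr a)).

Lemma antipode_cls t : antipode (cls t) = cls (term_antipode t).
Proof. apply/clsP/term_antipode_cong; exact: cong_repr. Qed.

Lemma antipode_linear : linear antipode.
Proof.
move=> c; elim/Pol_ind=> s; elim/Pol_ind=> t.
by rewrite -clsZ -clsD !antipode_cls /= clsD clsZ.
Qed.

HB.instance Definition _ := GRing.isLinear.Build R[i] (Pol R) (Pol R) _
  antipode antipode_linear.

Lemma antipodeM a b : antipode (a * b) = antipode b * antipode a.
Proof.
elim/Pol_ind: a => s; elim/Pol_ind: b => t.
by rewrite -clsM !antipode_cls /= clsM.
Qed.

Lemma antipode_gen i j : antipode (gen R i j) = gen R j i.
Proof. exact: antipode_cls. Qed.

End Antipode.

(* The library's dot products are linear in the first argument; [inner] is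
   linear in the second one. *)
HB.mixin Record CompleteNormedModule_isHilbert (R : realType) H
    of CompleteNormedModule R[i] H := {
  hdot : {dot H for (@Num.conj R[i])};
  hdot_norm : forall x : H, hdot x x = `|x| ^+ 2
}.

#[short(type="hilbertType")]
HB.structure Definition Hilbert (R : realType) :=
  {H of CompleteNormedModule R[i] H & CompleteNormedModule_isHilbert R H}.

Definition inner (R : realType) (H : hilbertType R) (x y : H) : R[i] := hdot y x.

Section Schurmann.
Variables (R : realType) (H : hilbertType R).

Definition is_projection (P : {linear H -> H}) : Prop :=
  [/\ continuous P, forall x, P (P x) = P x &
      forall x y, inner (P x) y = inner x (P y)].

(* Boundedness of an operator is continuity; the involution of B(H) is the
   adjoint, whence [rep_star]. *)
Record star_representation (rho : Pol R -> {linear H -> H}) : Prop := {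
  rep_bounded : forall a, continuous (rho a);
  rep_linear : forall c a b x, rho (c *: a + b) x = c *: rho a x + rho b x;
  rep1 : forall x, rho 1 x = x;
  repM : forall a b x, rho (a * b) x = rho a (rho b x);
  rep_star : forall a x y, inner (rho (star a) x) y = inner x (rho a y)
}.

Definition rhoPQ_mx (P Q : H -> H) (i j : 'I_4) : H -> H :=
  match nat_of_ord i, nat_of_ord j with
  | 0, 0 | 1, 1 => P
  | 0, 1 | 1, 0 => fun x => (x - P x)%R
  | 2, 2 | 3, 3 => Q
  | 2, 3 | 3, 2 => fun x => (x - Q x)%R
  | _, _ => fun=> 0%R
  end%N.

(* A *-representation is determined by its values on the generators. *)
Definition is_rhoPQ (P Q : {linear H -> H}) (rho : Pol R -> {linear H -> H}) :=
  star_representation rho /\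
  forall i j, rho (gen R i j) =1 rhoPQ_mx P Q i j.

Record schurmann_triple (rho : Pol R -> {linear H -> H})
    (eta : {linear Pol R -> H}) (L : {scalar Pol R}) : Prop := {
  triple_rep : star_representation rho;
  triple_cocycle : forall a b,
    eta (a * b) = rho a (eta b) + counit b *: eta a;
  triple_hermitian : forall a, L (star a) = (L a)^*;
  triple_coboundary : forall a b,
    L (star a * b) = inner (eta a) (eta b)
                     + counit (star a) * L b + L (star a) * counit b
}.

End Schurmann.

(* Main.v *)
From HB Require Import structures.
From mathcomp Require Import all_boot all_order all_algebra.
From mathcomp Require Import complex reals normedtype.
Require Import Defs.

Set Implicit Arguments.
Unset Strict Implicit.
Unset Printing Implicit Defensive.

Import GRing.Theory Num.Theory.

Local Open Scope ring_scope.

(** Put [bar a := antipode (star a)]. This is an antilinear multiplicative map,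
    which exchanges [gen i j] and [gen j i]. Since
    [antipode (star a * b) = star (bar b) * bar a], the coboundary identity
    turns the symmetry of [L] into the invariance
      [inner (eta (bar b)) (eta (bar a)) = inner (eta a) (eta b)],
    for all [a] and [b] ([symmetric_inner_bar], [inner_bar_symmetric]): the
    difference between [L] composed with the antipode and [L] is, under this
    invariance, an epsilon-derivation, and such a derivation vanishes because
    the generators are idempotents on which the counit is 0 or 1.

    The matrices [rho (gen i j)] and [eta (gen i j)] are symmetric in [i] and
    [j]. Hence [eta a] and [eta (bar a)] are combinations of the same vectors,
    with conjugate coefficients ([conj_combination_eta_bar]); these vectors
    are obtained from [xi] and [zeta] by applying words in [P] and [Q].
    Invariance therefore says that all inner products between such words
    applied to [xi] and [zeta] are real.

    Moving operators across the inner product leaves [inner u (w v)] with [u]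
    and [v] among [xi], [zeta] and [w] a word, which may be taken alternating.
    As [P xi = 0] and [Q zeta = 0], what survives is:
    - [u = v]: then [w] is a palindrome, so it is self-adjoint and the inner
      product is real whatever [P], [Q] and [v] are ([orbit_self_real]);
    - [u = zeta], [v = xi]: then [w] is a power of [P Q], and reality is exactly
      the condition of the theorem ([orbit_cross_real]).
    Conversely [(P Q)^k xi] is the value of [eta] at an element fixed by [bar]
    ([alternating_elt]), so that the invariance yields the condition. *)

(** * Generalities *)

Lemma ord4_ind (T : 'I_4 -> Prop) :
  T (inord 0) -> T (inord 1) -> T (inord 2) -> T (inord 3) -> forall i, T i.
Proof.
by move=> t0 t1 t2 t3 i; rewrite -(inord_val i);
  case: i => [[|[|[|[|]]]]].
Qed.

Lemma sum_ord4 (V : nmodType) (F : 'I_4 -> V) :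
  \sum_j F j = F (inord 0) + F (inord 1) + F (inord 2) + F (inord 3).
Proof.
rewrite !big_ord_recl big_ord0 addr0 !addrA.
by do ?congr (_ + _); congr F; apply: val_inj; rewrite /= inordK.
Qed.

Section InnerProduct.
Variables (R : realType) (H : hilbertType R).
Implicit Types x y z : H.

Lemma inner0l y : inner 0 y = 0. Proof. exact: linear0r. Qed.

Lemma inner0r x : inner x 0 = 0. Proof. exact: linear0l. Qed.

Lemma innerPl c x y z : inner (c *: x + y) z = c^* * inner x z + inner y z.
Proof. exact: linearPr. Qed.

Lemma innerPr c x y z : inner z (c *: x + y) = c * inner z x + inner z y.
Proof. exact: linearPl. Qed.

End InnerProduct.

(** * The conjugate of the antipode *)

Section PolInvolution.
Variable R : realType.
Implicit Types (a b : Pol R) (c : R[i]).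

Lemma star0 : star (0 : Pol R) = 0.
Proof. by rewrite -[in LHS](scale0r (0 : Pol R)) starZ conjC0 scale0r. Qed.

Lemma star1 : star (1 : Pol R) = 1.
Proof. by rewrite -[star 1]mul1r -[X in X * _]starK -starM mul1r starK. Qed.

(** The algebra is spanned by the words in the generators. Star is removed by
    proving closure under left multiplication by each expression together with
    its adjoint, since the generators are self-adjoint. *)
Lemma Pol_left_ind (T : Pol R -> Prop) :
    T 1 -> (forall c a b, T a -> T b -> T (c *: a + b)) ->
    (forall i j a, T a -> T (gen R i j * a)) ->
  forall a, T a.
Proof.
move=> T1 TP TG.
have T0 : T 0 by have := TP (-1) _ _ T1 T1; rewrite scaleN1r addNr.
have TZ c a : T a -> T (c *: a) by move=> Ta; rewrite -[_ *: _]addr0; exact: TP.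
have TD a b : T a -> T b -> T (a + b) by rewrite -{2}[a]scale1r; exact: TP.
suff M t : (forall a, T a -> T (cls t * a)) /\
           (forall a, T a -> T (star (cls t) * a)).
  by elim/Pol_ind=> t; rewrite -[cls t]mulr1; exact: (M t).1.
elim: t => [i j|||s [s1 s2] t [t1 t2]|s [s1 s2] t [t1 t2]|c s [s1 s2]|s [s1 s2]].
- by rewrite (magic_star (gen_magic R)); split=> a; exact: TG.
- by rewrite cls0 star0; split=> a _; rewrite mul0r.
- by rewrite cls1 star1; split=> a; rewrite mul1r.
- by rewrite clsD starD; split=> a Ta; rewrite mulrDl; apply: TD; auto.
- by rewrite clsM starM; split=> a Ta; rewrite -mulrA; auto.
- by rewrite clsZ starZ; split=> a Ta; rewrite -scalerAl; auto.
- by rewrite clsS starK.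
Qed.

Lemma antipode_star a : antipode (star a) = star (antipode a).
Proof. by elim/Pol_ind: a => t; rewrite -clsS !antipode_cls -clsS. Qed.

Lemma antipode1 : antipode (1 : Pol R) = 1.
Proof. by rewrite -cls1 antipode_cls. Qed.

Lemma counit_antipode a : counit (antipode a) = counit a.
Proof.
elim/Pol_left_ind: a; first by rewrite antipode1.
  by move=> c a b ea eb; rewrite antipode_linear !linearP /= ea eb.
move=> i j a ea; rewrite antipodeM antipode_gen !rmorphM /= ea !counit_gen.
by rewrite mulrC eq_sym.
Qed.

(** Both the antipode and the star reverse products, so their composite is
    multiplicative, unlike either of them. *)
Definition bar a := antipode (star a).

Lemma barP c a b : bar (c *: a + b) = c^* *: bar a + bar b.
Proof. by rewrite /bar starD starZ antipode_linear. Qed.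

Lemma barM a b : bar (a * b) = bar a * bar b.
Proof. by rewrite /bar starM antipodeM. Qed.

Lemma bar1 : bar 1 = 1. Proof. by rewrite /bar star1 antipode1. Qed.

Lemma bar_gen i j : bar (gen R i j) = gen R j i.
Proof. by rewrite /bar (magic_star (gen_magic R)) antipode_gen. Qed.

Lemma counit_bar a : counit (bar a) = (counit a)^*.
Proof. by rewrite /bar counit_antipode counit_star. Qed.

(** This puts the antipode of [star a * b] back into the shape to which the
    coboundary identity applies, with the two arguments exchanged. *)
Lemma antipode_star_mul a b : antipode (star a * b) = star (bar b) * bar a.
Proof. by rewrite antipodeM /bar -[star (antipode (star b))]antipode_star starK. Qed.

End PolInvolution.

(** * Words in two projections *)

Section Orbit.
Variables (R : realType) (H : hilbertType R).

Inductive orbit (P Q : H -> H) (v : H) : H -> Prop :=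
| orbit_base : orbit P Q v v
| orbit_P x : orbit P Q v x -> orbit P Q v (P x)
| orbit_Q x : orbit P Q v x -> orbit P Q v (Q x).

Lemma orbit_swap P Q v x : orbit P Q v x -> orbit Q P v x.
Proof.
by elim=> [|y _ oy|y _ oy]; [exact: orbit_base|exact: orbit_Q|exact: orbit_P].
Qed.

Variables P Q : {linear H -> H}.
Hypotheses (projP : is_projection P) (projQ : is_projection Q).

(** Repeated letters of a word collapse by idempotence, and a word that applies
    [P] first kills [v]. *)
Lemma orbit_alternating v x : P v = 0 -> orbit P Q v x ->
  [\/ x = 0, exists k, x = iter k (P \o Q) v |
      exists k, x = Q (iter k (P \o Q) v)].
Proof.
case: projP projQ => [_ PP _] [_ QQ _] Pv.
elim=> [|_ _ [->|[k ->]|[k ->]]|_ _ [->|[k ->]|[k ->]]].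
- by apply: Or32; exists 0.
- by apply: Or31; rewrite linear0.
- case: k => [|k]; first by apply: Or31.
  by apply: Or32; exists k.+1; rewrite /= PP.
- by apply: Or32; exists k.+1.
- by apply: Or31; rewrite linear0.
- by apply: Or33; exists k.
- by apply: Or33; exists k; rewrite QQ.
Qed.

Lemma inner_iter k x y :
  inner (iter k (Q \o P) x) y = inner x (iter k (P \o Q) y).
Proof.
case: projP projQ => [_ _ adjP] [_ _ adjQ].
by elim: k x y => //= k IH x y; rewrite adjQ adjP IH -iterSr.
Qed.

(** Up to vectors orthogonal to [v], which lies in the kernel of [P], the orbit
    consists of [v] and of the images of [v] under the words
    [Q P Q ... P Q], which are palindromes, hence self-adjoint. *)
Lemma orbit_self_real v x : P v = 0 -> orbit P Q v x -> inner v x = inner x v.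
Proof.
move=> Pv /(orbit_alternating Pv).
case: projP projQ => [_ PP adjP] [_ QQ adjQ] [->|[[|k] ->]|[k ->]].
- by rewrite inner0l inner0r.
- by [].
- by rewrite /= adjP -adjP Pv inner0l inner0r.
- rewrite -adjQ -inner_iter; congr (inner _ v).
  by elim: k => //= k ->.
Qed.

(** A word whose last applied letter is [Q] gives a vector orthogonal to [zeta],
    so only the powers of [P Q] contribute. *)
Lemma orbit_cross_real xi zeta x :
    P xi = 0 -> Q zeta = 0 ->
    (forall k, let v := iter k (P \o Q) xi in inner zeta v = inner v zeta) ->
  orbit P Q xi x -> inner zeta x = inner x zeta.
Proof.
move=> Pxi Qzeta real /(orbit_alternating Pxi).
case: projQ => [_ _ adjQ] [->|[k ->]|[k ->]].
- by rewrite inner0l inner0r.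
- exact: real.
- by rewrite -adjQ Qzeta inner0l adjQ Qzeta inner0r.
Qed.

(** Self-adjointness moves the letters of [x] onto [y], which stays in its
    orbit. *)
Lemma orbit_real (u v : H) :
    (forall y, orbit P Q v y -> inner u y = inner y u) ->
  forall x y, orbit P Q u x -> orbit P Q v y -> inner x y = inner y x.
Proof.
case: projP projQ => [_ _ adjP] [_ _ adjQ] base x y ox.
elim: ox y => [|{}x _ IH|{}x _ IH] y oy; first exact: base.
  by rewrite adjP IH ?adjP //; exact: orbit_P.
by rewrite adjQ IH ?adjQ //; exact: orbit_Q.
Qed.

End Orbit.

(** * Combinations with conjugate coefficients *)

Section ConjugateCombinations.
Variables (R : realType) (H : hilbertType R) (V : H -> Prop).

(** Pairs of a sum of [c_i *: v_i] and the sum of [c_i^* *: v_i] over the same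
    vectors of [V]. A relation is used, as the second component is not
    determined by the first one when [V] is linearly dependent. *)
Inductive conj_combination : H -> H -> Prop :=
| conj_combination0 : conj_combination 0 0
| conj_combinationP c v x y : V v -> conj_combination x y ->
    conj_combination (c *: v + x) (c^* *: v + y).

Lemma conj_combination_mem v : V v -> conj_combination v v.
Proof.
move=> Vv; have := conj_combinationP 1 Vv conj_combination0.
by rewrite conjC1 scale1r addr0.
Qed.

Lemma conj_combination_lin c x y x' y' :
    conj_combination x y -> conj_combination x' y' ->
  conj_combination (c *: x + x') (c^* *: y + y').
Proof.
move=> xy xy'; elim: xy => [|d v {}x {}y Vv _ IH]; first by rewrite !scaler0 !add0r.
rewrite !scalerDr !scalerA -!addrA -rmorphM; exact: conj_combinationP.
Qed.

Lemma conj_combination_map (f : {linear H -> H}) x y :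
    (forall v, V v -> V (f v)) -> conj_combination x y ->
  conj_combination (f x) (f y).
Proof.
move=> Vf; elim=> [|c v {}x {}y Vv _ IH]; first by rewrite linear0; constructor.
by rewrite !linearP; apply: conj_combinationP => //; exact: Vf.
Qed.

(** Both sides are linear in the coefficients of [x'] and antilinear in those
    of [x], so it is enough to compare them on [V]. *)
Lemma inner_conj_combination x y x' y' :
    (forall v w, V v -> V w -> inner v w = inner w v) ->
    conj_combination x y -> conj_combination x' y' ->
  inner y' y = inner x x'.
Proof.
move=> Vreal xy xy'; elim: xy => [|c v {}x {}y Vv _ IH].
  by rewrite inner0l inner0r.
rewrite innerPl innerPr IH; congr (_ * _ + _).
elim: {IH} xy' => [|d w {}x' {}y' Vw _ IH']; first by rewrite inner0l inner0r.
by rewrite innerPl innerPr IH' conjCK Vreal.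
Qed.

End ConjugateCombinations.

(** * The cocycle *)

Section Cocycle.
Variables (R : realType) (H : hilbertType R) (P Q : {linear H -> H}).
Variables (rho : Pol R -> {linear H -> H}) (eta : {linear Pol R -> H}).
Hypothesis rhoE : is_rhoPQ P Q rho.
Hypothesis etaM :
  forall a b, eta (a * b) = rho a (eta b) + counit b *: eta a.

Notation g := (gen R).
Let xi := eta (g (inord 0) (inord 0)).
Let zeta := eta (g (inord 2) (inord 2)).

Lemma eta1 : eta 1 = 0.
Proof.
have := etaM 1 1; rewrite mulr1 (rep1 rhoE.1) rmorph1 scale1r => /eqP.
by rewrite -subr_eq0 opprD addNKr oppr_eq0 => /eqP.
Qed.

(** The cocycle identity for the idempotent [gen i i], whose counit is 1. *)
Lemma eta_gen_fix i : rho (g i i) (eta (g i i)) = 0.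
Proof.
have := etaM (g i i) (g i i).
rewrite (magic_idem (gen_magic R)) counit_gen eqxx scale1r => /eqP.
by rewrite -subr_eq0 opprD addrCA subrr addr0 oppr_eq0 => /eqP.
Qed.

Lemma P_xi : P xi = 0.
Proof. by have := eta_gen_fix (inord 0); rewrite rhoE.2 /rhoPQ_mx !inordK. Qed.

Lemma Q_zeta : Q zeta = 0.
Proof. by have := eta_gen_fix (inord 2); rewrite rhoE.2 /rhoPQ_mx !inordK. Qed.

Definition eta_mx (x z : H) (i j : 'I_4) : H :=
  match nat_of_ord i, nat_of_ord j with
  | 0, 0 | 1, 1 => x
  | 0, 1 | 1, 0 => (- x)%R
  | 2, 2 | 3, 3 => z
  | 2, 3 | 3, 2 => (- z)%R
  | _, _ => 0%R
  end%N.

(** Off the two diagonal blocks [rho] and the counit both vanish on the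
    idempotent [gen i j], and hence so does [eta]. The rows and columns sum
    to 1, where [eta] is 0; this determines each block from its corner. *)
Lemma eta_gen i j : eta (g i j) = eta_mx xi zeta i j.
Proof.
have off k l : (k == l) = false -> rhoPQ_mx P Q k l = (fun=> 0) ->
    eta (g k l) = 0.
  move=> kl rho0; rewrite -(magic_idem (gen_magic R)) etaM rhoE.2 rho0.
  by rewrite counit_gen kl scale0r addr0.
have row k : \sum_l eta (g k l) = 0.
  by rewrite -linear_sum (magic_rowsum (gen_magic R)) eta1.
have col l : \sum_k eta (g k l) = 0.
  by rewrite -linear_sum (magic_colsum (gen_magic R)) eta1.
have opp (x y : H) : x + y = 0 -> y = - x.
  by move=> /eqP; rewrite addrC addr_eq0 => /eqP.
have offE (m n : nat) : (m < 4)%N -> (n < 4)%N -> (m < 2)%N != (n < 2)%N ->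
    eta (g (inord m) (inord n)) = 0.
  move=> m4 n4 mn; apply: off.
    apply/eqP => /(congr1 val) /=; rewrite !inordK // => e.
    by rewrite e eqxx in mn.
  by rewrite /rhoPQ_mx !inordK //; move: m n {m4 n4} mn => [|[|[|[|m]]]] [|[|[|[|n]]]].
have e01 : eta (g (inord 0) (inord 1)) = - xi.
  by apply: opp; rewrite -(row (inord 0)) sum_ord4 (offE 0 2)%N // (offE 0 3)%N // !addr0.
have e10 : eta (g (inord 1) (inord 0)) = - xi.
  by apply: opp; rewrite -(col (inord 0)) sum_ord4 (offE 2 0)%N // (offE 3 0)%N // !addr0.
have e11 : eta (g (inord 1) (inord 1)) = xi.
  rewrite -[xi]opprK -e10.
  by apply: opp; rewrite -(row (inord 1)) sum_ord4 (offE 1 2)%N // (offE 1 3)%N // !addr0.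
have e23 : eta (g (inord 2) (inord 3)) = - zeta.
  by apply: opp; rewrite -(row (inord 2)) sum_ord4 (offE 2 0)%N // (offE 2 1)%N // !add0r.
have e32 : eta (g (inord 3) (inord 2)) = - zeta.
  by apply: opp; rewrite -(col (inord 2)) sum_ord4 (offE 0 2)%N // (offE 1 2)%N // !add0r.
have e33 : eta (g (inord 3) (inord 3)) = zeta.
  rewrite -[zeta]opprK -e32.
  by apply: opp; rewrite -(row (inord 3)) sum_ord4 (offE 3 0)%N // (offE 3 1)%N // !add0r.
by elim/ord4_ind: i; elim/ord4_ind: j; rewrite /eta_mx !inordK //; exact: offE.
Qed.

Let V v := orbit P Q xi v \/ orbit P Q zeta v.

(** The cocycle identity computes [eta (gen i j * a)] and
    [eta (gen j i * bar a)] by one formula, by the symmetry of the two matrices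
    and up to conjugation of the counit. *)
Lemma conj_combination_eta_bar a :
  conj_combination V (eta a) (eta (bar a)).
Proof.
have V_P v : V v -> V (P v) by case=> o; [left|right]; exact: orbit_P.
have V_Q v : V v -> V (Q v) by case=> o; [left|right]; exact: orbit_Q.
have CPQ := conj_combination_lin.
have C0 := conj_combination0 V.
have Cxi : conj_combination V xi xi.
  by apply/conj_combination_mem; left; exact: orbit_base.
have Czeta : conj_combination V zeta zeta.
  by apply/conj_combination_mem; right; exact: orbit_base.
have CN x y : conj_combination V x y -> conj_combination V (- x) (- y).
  move=> xy; have := CPQ _ _ _ (-1) _ _ _ _ xy C0.
  by rewrite rmorphN1 !scaleN1r !addr0.
have CD x y x' y' : conj_combination V x y -> conj_combination V x' y' ->
    conj_combination V (x + x') (y + y').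
  by move=> xy xy'; have := CPQ _ _ _ 1 _ _ _ _ xy xy'; rewrite conjC1 !scale1r.
have CP x y (xy : conj_combination V x y) := conj_combination_map V_P xy.
have CQ x y (xy : conj_combination V x y) := conj_combination_map V_Q xy.
elim/Pol_left_ind: a => [|c a b Ca Cb|i j a Ca].
- by rewrite bar1 eta1.
- by rewrite barP !linearP; exact: CPQ.
rewrite barM bar_gen !etaM counit_bar !rhoE.2 !eta_gen.
rewrite addrC [X in conj_combination _ _ X]addrC.
apply: CPQ.
  by elim/ord4_ind: i; elim/ord4_ind: j; rewrite /eta_mx !inordK //; exact: CN.
by elim/ord4_ind: i; elim/ord4_ind: j; rewrite /rhoPQ_mx !inordK //; auto.
Qed.

(** Subtracting 1 does not change [eta], and it makes the counit vanish; then
    left multiplication acts on [eta] through [rho] alone. *)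
Fixpoint alternating_elt k : Pol R :=
  if k is k'.+1 then
    g (inord 0) (inord 0) * (g (inord 2) (inord 2) * alternating_elt k')
  else g (inord 0) (inord 0) - 1.

Lemma counit_alternating_elt k : counit (alternating_elt k) = 0.
Proof.
elim: k => [|k IH] /=; first by rewrite rmorphB rmorph1 /= counit_gen eqxx subrr.
by rewrite !rmorphM /= IH !mulr0.
Qed.

Lemma eta_alternating_elt k : eta (alternating_elt k) = iter k (P \o Q) xi.
Proof.
elim: k => [|k IH] /=; first by rewrite linearB /= eta1 subr0.
rewrite !etaM rmorphM /= counit_alternating_elt mulr0 !scale0r !addr0 !rhoE.2.
by rewrite /rhoPQ_mx !inordK // IH.
Qed.

Lemma bar_alternating_elt k : bar (alternating_elt k) = alternating_elt k.
Proof.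
elim: k => [|k IH] /=; last by rewrite !barM !bar_gen IH.
by rewrite addrC -scaleN1r barP bar1 bar_gen rmorphN1.
Qed.

End Cocycle.

(** * Symmetry of the generating functional *)

Section Symmetry.
Variables (R : realType) (H : hilbertType R).
Variables (rho : Pol R -> {linear H -> H}) (eta : {linear Pol R -> H}).
Variable L : {scalar Pol R}.
Hypothesis triple : schurmann_triple rho eta L.

(** The terms of the coboundary identity that involve the counit are the same
    for [star a * b] and for its antipode, up to order. *)
Lemma symmetric_inner_bar a b :
    L \o @antipode R =1 L ->
  inner (eta (bar b)) (eta (bar a)) = inner (eta a) (eta b).
Proof.
move=> sym; have := sym (star a * b); rewrite /= antipode_star_mul.
have symS x : L (star (bar x)) = L x.
  by rewrite /bar antipode_star starK -[RHS]sym.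
have symb x : L (bar x) = L (star x) by rewrite -[RHS]sym.
rewrite !(triple_coboundary triple) symS symb !counit_star !counit_bar conjCK.
by rewrite addrAC [X in _ + X + _]mulrC [X in _ + _ + X = _]mulrC => /addIr/addIr.
Qed.

(** Under the invariance, [L] and its composite with the antipode satisfy the
    same recursion for left multiplication by a generator; it remains to
    compare their values on generators. *)
Lemma inner_bar_symmetric :
  (forall a b, inner (eta (bar b)) (eta (bar a)) = inner (eta a) (eta b)) ->
  L \o @antipode R =1 L.
Proof.
move=> invar.
pose g := gen R.
have gS i j : star (g i j) = g i j by exact: magic_star (gen_magic R) i j.
have LgM i j b : L (g i j * b) =
    inner (eta (g i j)) (eta b) + (i == j)%:R * L b + L (g i j) * counit b.
  by rewrite -{1}gS (triple_coboundary triple) gS counit_gen.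
have LSgM i j b : L (antipode (g i j * b)) = inner (eta (g i j)) (eta b)
    + (i == j)%:R * L (antipode b) + L (g j i) * counit b.
  rewrite -{1}gS antipode_star_mul (triple_coboundary triple) invar.
  rewrite /bar antipode_star starK counit_antipode gS antipode_gen counit_gen.
  by rewrite eq_sym -!addrA; congr (_ + _); rewrite addrC mulrC [X in _ + X]mulrC.
(* For [f] the difference of the two functionals, idempotence gives
   [f p = 2 * epsilon p * f p] at a generator [p]; for [i = j] the claim is
   trivial, and for [i <> j] the counit is 0. *)
have Lg i j : L (g j i) = L (g i j).
  have := LSgM i j (g i j); have := LgM i j (g i j).
  rewrite (magic_idem (gen_magic R)) -/g antipode_gen -/(g j i) counit_gen.
  case: eqP => [-> //|_]; rewrite !mul0r !mulr0 !addr0.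
  by move=> -> ->.
elim/Pol_left_ind => [|c a b La Lb|i j a La] /=.
- by rewrite antipode1.
- by rewrite !linearP -[RHS]/(c * L a + L b) -La -Lb.
- by rewrite LSgM LgM Lg -[L a]La.
Qed.

End Symmetry.

Theorem theorem10p4 (R : realType) (H : hilbertType R) (P Q : {linear H -> H})
    (rho : Pol R -> {linear H -> H}) (eta : {linear Pol R -> H})
    (L : {scalar Pol R}) :
  is_projection P -> is_projection Q ->
  is_rhoPQ P Q rho -> schurmann_triple rho eta L ->
  let xi := eta (gen R (inord 0) (inord 0)) in
  let zeta := eta (gen R (inord 2) (inord 2)) in
  (L \o @antipode R =1 L) <->
  (forall k : nat, let v := iter k (P \o Q) xi in inner zeta v = inner v zeta).
Proof.
move=> projP projQ rhoE triple xi zeta.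
have etaM := triple_cocycle triple.
split=> [sym k v|real].
  have := symmetric_inner_bar triple (gen R (inord 2) (inord 2))
    (alternating_elt R k) sym.
  by rewrite bar_alternating_elt bar_gen (eta_alternating_elt rhoE etaM).
have Pxi : P xi = 0 := P_xi rhoE etaM.
have Qzeta : Q zeta = 0 := Q_zeta rhoE etaM.
have xixi := orbit_real projP projQ
  (fun y => @orbit_self_real _ _ _ _ projP projQ _ y Pxi).
have zetazeta := orbit_real projP projQ (fun y oy =>
  orbit_self_real projQ projP Qzeta (orbit_swap oy)).
have zetaxi := orbit_real projP projQ (fun y =>
  @orbit_cross_real _ _ _ _ projP projQ _ _ y Pxi Qzeta real).
apply: (inner_bar_symmetric triple) => a b.
apply: inner_conj_combination (conj_combination_eta_bar rhoE etaM a)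
  (conj_combination_eta_bar rhoE etaM b).
move=> v w [ov|ov] [ow|ow].
- exact: xixi.
- by apply/esym; exact: zetaxi.
- exact: zetaxi.
- exact: zetazeta.
Qed.
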